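(* Let $(M,g,\nabla)$ be a statistical manifold of dimension $n\ge 3$, let $\nabla^{*}$ be the dual connection of $\nabla$ with respect to $g$, and let $W$ and $W^{*}$ be the conformal-projective curvature tensors of the statistical manifold $(M,g,\nabla)$ and of the dual statistical manifold $(M,g,\nabla^{*})$, respectively. Then $$g(W(X,Y)Z,U)+g(W^{*}(X,Y)U,Z)=0$$ for all smooth vector fields $X,Y,Z,U$ on $M$.
   Context: A statistical manifold $(M,g,\nabla)$ is a smooth manifold $M$ of dimension $n$ with a Riemannian metric $g$ and a torsion-free affine connection $\nabla$ such that $\nabla g$ is a totally symmetric $(0,3)$-tensor field. The dual connection $\nabla^{*}$ is defined by $X\,g(Y,Z)=g(\nabla_XY,Z)+g(Y,\nabla^{*}_XZ)$; it is torsion-free and $(M,g,\nabla^{*})$ is again a statistical manifold (the dual statistical manifold), whose dual connection is $\nabla$. The curvature tensor of $\nabla$ is $R(X,Y)Z=\nabla_X\nabla_YZ-\nabla_Y\nabla_XZ-\nabla_{[X,Y]}Z$. The Ricci tensor is $\mathrm{Ric}(Y,Z)=\mathrm{tr}\{X\mapsto R(X,Y)Z\}$ (not assumed symmetric), the Ricci operator $\mathrm{Ric}^{\sharp}$ is the $(1,1)$-tensor field with $g(\mathrm{Ric}^{\sharp}(X),Y)=\mathrm{Ric}(X,Y)$, and the scalar curvature is $\sigma=\mathrm{tr}_g\mathrm{Ric}$. The corresponding quantities for $\nabla^{*}$ are $R^{*},\mathrm{Ric}^{*},\mathrm{Ric}^{*\sharp},\sigma^{*}$. The conformal-projective curvature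 tensor $W$ of $(M,g,\nabla)$ is $$\begin{aligned}W(X,Y)Z={}&R(X,Y)Z+\frac{1}{n(n-2)}\Big\{[(n-1)\mathrm{Ric}(X,Z)+\mathrm{Ric}^{*}(X,Z)]\,Y-[(n-1)\mathrm{Ric}(Y,Z)+\mathrm{Ric}^{*}(Y,Z)]\,X\\&+g(X,Z)\,[(n-1)\mathrm{Ric}^{*\sharp}(Y)+\mathrm{Ric}^{\sharp}(Y)]-g(Y,Z)\,[(n-1)\mathrm{Ric}^{*\sharp}(X)+\mathrm{Ric}^{\sharp}(X)]\Big\}\\&+\frac{\sigma}{(n-1)(n-2)}\,[g(Y,Z)X-g(X,Z)Y].\end{aligned}$$ The tensor $W^{*}$ is the conformal-projective curvature tensor of $(M,g,\nabla^{*})$, i.e. it is given by the same formula with the roles of the unstarred and starred quantities interchanged. *)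

(* Defs.v *)
From HB Require Import structures.
From mathcomp Require Import all_boot all_order all_algebra.
From mathcomp Require Import ring.
From mathcomp Require Import all_classical all_reals all_analysis.

Set Implicit Arguments.
Unset Strict Implicit.
Unset Printing Implicit Defensive.

Import Order.TTheory GRing.Theory Num.Theory.
Import numFieldNormedType.Exports.

Local Open Scope classical_set_scope.
Local Open Scope ring_scope.

Section SmoothOn.
Context {R : realType} {n : nat}.
Implicit Types (A : set 'rV[R]_n) (f g : 'rV[R]_n -> R) (k : nat).

(* f is C^k on A (used for A open): all iterated partial derivatives of order
   at most k exist and are continuous at every point of A. *)
Fixpoint Ck_on k A f : Prop :=
  {in A, continuous f} /\
  if k is k'.+1 then
    forall i : 'I_n, {in A, forall x, derivable f x (delta_mx 0 i)} /\
                     Ck_on k' A ('D_(delta_mx 0 i) f)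
  else True.

Definition smooth_on A f : Prop := forall k, Ck_on k A f.

Lemma Ck_on_continuous k A f : Ck_on k A f -> {in A, continuous f}.
Proof. by case: k => [|k] []. Qed.

Lemma Ck_onW k A f : Ck_on k.+1 A f -> Ck_on k A f.
Proof.
elim: k f => [|k IH] f; first by case.
by move=> [fc fd]; split=> // i; have [? /IH] := fd i.
Qed.

Lemma Ck_on_ext k A f g : open A -> {in A, f =1 g} -> Ck_on k A f -> Ck_on k A g.
Proof.
move=> oA; elim: k f g => [|k IH] f g fg.
all: have near x : x \in A -> \near x, f x = g x
  by move=> xA; apply: filterS (open_nbhs_nbhs (conj oA (set_mem xA))) => y yA;
     apply: fg; rewrite inE.
all: have gc : {in A, continuous f} -> {in A, continuous g}
  by move=> fc x xA; apply: cvg_trans; [exact: near_eq_cvg (near x xA) |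
     rewrite -(fg x xA); exact: fc].
  by case=> fc _; split=> //; exact: gc.
move=> [fc fd]; split; first exact: gc.
move=> i; have [fdi fDi] := fd i; split.
  by move=> x xA; apply: near_eq_derivable (fdi x xA); exact: near.
by apply: IH fDi => x xA; apply: near_eq_derive; exact: near.
Qed.

Lemma Ck_on_cst k A (a : R) : Ck_on k A (cst a).
Proof.
elim: k a => [|k IH] a; split=> //; try by move=> x _; exact: cst_continuous.
move=> i; split; first by move=> x _; exact: derivable_cst.
suff -> : 'D_(delta_mx 0 i) (cst a : 'rV[R]_n -> R) = cst 0 by exact: IH.
by apply/funext => x; rewrite derive_cst.
Qed.

Lemma Ck_onD k A f g : open A -> Ck_on k A f -> Ck_on k A g -> Ck_on k A (f \+ g).
Proof.
move=> oA; elim: k f g => [|k IH] f g [fc fd] [gc gd].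
all: split=> //; first by move=> x xA; exact: continuousD (fc x xA) (gc x xA).
move=> i; have [fdi fDi] := fd i; have [gdi gDi] := gd i; split.
  by move=> x xA; apply: derivableD; [exact: fdi|exact: gdi].
apply: Ck_on_ext (IH _ _ fDi gDi) => // x xA.
by rewrite /= deriveD //; [exact: fdi|exact: gdi].
Qed.

Lemma Ck_onM k A f g : open A -> Ck_on k A f -> Ck_on k A g -> Ck_on k A (f \* g).
Proof.
move=> oA; elim: k f g => [|k IH] f g fk gk.
all: have [fc fd] := fk; have [gc gd] := gk.
all: split=> //; first by move=> x xA; exact: continuousM (fc x xA) (gc x xA).
move=> i; have [fdi fDi] := fd i; have [gdi gDi] := gd i; split.
  by move=> x xA; apply: derivableM; [exact: fdi|exact: gdi].
have := Ck_onD oA (IH _ _ (Ck_onW fk) gDi) (IH _ _ (Ck_onW gk) fDi).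
apply: Ck_on_ext => // x xA.
by rewrite /= deriveM //; [exact: fdi|exact: gdi].
Qed.

End SmoothOn.

Section Manifold.
Context {R : realType} {n : nat}.

(* The local inverse cinv is a total function, meaningful only on cmap @` cdom. *)
Record chart (M : topologicalType) := Chart {
  cdom : set M;
  cmap : M -> 'rV[R]_n;
  cinv : 'rV[R]_n -> M;
  cdom_open : open cdom;
  cimg_open : open (cmap @` cdom);
  cmapK : {in cdom, cancel cmap cinv};
  cmap_continuous : {within cdom, continuous cmap};
  cinv_continuous : {within cmap @` cdom, continuous cinv} }.

Definition compatible_charts (M : topologicalType) (c d : chart M) : Prop :=
  forall j : 'I_n,
    smooth_on (cmap c @` (cdom c `&` cdom d)) (fun x => cmap d (cinv c x) 0 j).

End Manifold.

Record manifold (R : realType) (n : nat) := Manifold {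
  manifold_carrier :> topologicalType;
  manifold_hausdorff : hausdorff_space manifold_carrier;
  manifold_second_countable : @second_countable manifold_carrier;
  atlas : set (@chart R n manifold_carrier);
  atlas_cover : forall p : manifold_carrier, exists2 c, atlas c & cdom c p;
  atlas_compatible : forall c d, atlas c -> atlas d -> compatible_charts c d }.

Section SmoothFunctions.
Context {R : realType} {n : nat} (M : manifold R n).

Definition smooth (f : M -> R) : Prop :=
  forall c, @atlas R n M c -> smooth_on (cmap c @` cdom c) (f \o cinv c).

Definition smooth_pred : {pred M -> R} := mem [set f | smooth f].

Lemma smooth_predP f : reflect (smooth f) (f \in smooth_pred).
Proof. by apply: (iffP idP) => [/set_mem|/mem_set]. Qed.

Lemma smooth_cst (a : R) : smooth (cst a).
Proof. by move=> c _ k; exact: Ck_on_cst. Qed.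

Lemma smoothD f g : smooth f -> smooth g -> smooth (f + g).
Proof. by move=> sf sg c cA k; apply: Ck_onD (sf c cA k) (sg c cA k); exact: cimg_open. Qed.

Lemma smoothM f g : smooth f -> smooth g -> smooth (f * g).
Proof. by move=> sf sg c cA k; apply: Ck_onM (sf c cA k) (sg c cA k); exact: cimg_open. Qed.

Lemma smooth_subring_closed : subring_closed smooth_pred.
Proof.
split.
- by apply/smooth_predP; exact: smooth_cst.
- move=> f g /smooth_predP sf /smooth_predP sg; apply/smooth_predP/smoothD => //.
  have -> : - g = cst (-1) * g by apply/funext => x /=; rewrite !fctE mulN1r.
  by apply: smoothM => //; exact: smooth_cst.
- by move=> f g /smooth_predP sf /smooth_predP sg; apply/smooth_predP/smoothM.
Qed.

HB.instance Definition _ :=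
  GRing.isSubringClosed.Build (M -> R) smooth_pred smooth_subring_closed.

End SmoothFunctions.

Record Cinf (R : realType) (n : nat) (M : manifold R n) := MkCinf {
  Cinf_fun :> M -> R;
  Cinf_mem : Cinf_fun \in @smooth_pred R n M }.

HB.instance Definition _ (R : realType) (n : nat) (M : manifold R n) :=
  [isSub for @Cinf_fun R n M].
HB.instance Definition _ (R : realType) (n : nat) (M : manifold R n) :=
  [Choice of Cinf M by <:].
HB.instance Definition _ (R : realType) (n : nat) (M : manifold R n) :=
  GRing.SubChoice_isSubComPzRing.Build (M -> R) (@smooth_pred R n M) (Cinf M)
    (@smooth_subring_closed R n M).

Section Tangent.
Context {R : realType} {n : nat} {M : manifold R n}.

Lemma CinfP (f : Cinf M) : smooth f.
Proof. exact/smooth_predP/Cinf_mem. Qed.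

Definition to_Cinf (f : M -> R) (sf : smooth f) : Cinf M :=
  MkCinf (introT (smooth_predP f) sf).

Definition Cinf_cst (a : R) : Cinf M := to_Cinf (smooth_cst a).

Lemma Cinf_eq (f g : Cinf M) : f =1 g -> f = g.
Proof. by move=> fg; apply/val_inj/funext. Qed.

Definition derivation_at (p : M) (v : Cinf M -> R) : Prop :=
  (forall (a : R) (f h : Cinf M), v (Cinf_cst a * f + h) = a * v f + v h) /\
  (forall f h : Cinf M, v (f * h) = f p * v h + h p * v f).

Definition derivation_pred (p : M) : {pred Cinf M -> R} :=
  mem [set v | derivation_at p v].

Lemma derivation_predP p v : reflect (derivation_at p v) (v \in derivation_pred p).
Proof. by apply: (iffP idP) => [/set_mem|/mem_set]. Qed.

Lemma derivation_submod_closed p : submod_closed (derivation_pred p).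
Proof.
split.
  have z g : (0 : Cinf M -> R) g = 0 by [].
  by apply/derivation_predP; split=> [a f h|f h]; rewrite !z !mulr0 addr0.
move=> a u v /derivation_predP[uL uM] /derivation_predP[vL vM].
have e g : (a *: u + v) g = a * u g + v g by [].
apply/derivation_predP; split=> [b f h|f h]; rewrite !e ?uL ?vL ?uM ?vM; ring.
Qed.

HB.instance Definition _ (p : M) :=
  GRing.isSubmodClosed.Build R (Cinf M -> R) (derivation_pred p)
    (derivation_submod_closed p).

End Tangent.

(* The tangent space T_pM, as the space of derivations at p of C^oo(M). *)
Record tangent (R : realType) (n : nat) (M : manifold R n) (p : M) := MkTangent {
  tangent_fun :> Cinf M -> R;
  tangent_mem : tangent_fun \in derivation_pred p }.

HB.instance Definition _ (R : realType) (n : nat) (M : manifold R n) (p : M) :=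
  [isSub for @tangent_fun R n M p].
HB.instance Definition _ (R : realType) (n : nat) (M : manifold R n) (p : M) :=
  [Choice of tangent p by <:].
HB.instance Definition _ (R : realType) (n : nat) (M : manifold R n) (p : M) :=
  [SubChoice_isSubLmodule of tangent p by <:].

(* Smooth vector fields: sections X of TM such that X f is smooth for every
   smooth f. *)
Record vfield (R : realType) (n : nat) (M : manifold R n) := MkVField {
  vfield_at :> forall p : M, tangent p;
  vfield_smooth : forall f : Cinf M, smooth (fun p => vfield_at p f) }.

HB.instance Definition _ (R : realType) (n : nat) (M : manifold R n) :=
  gen_eqMixin (vfield M).
HB.instance Definition _ (R : realType) (n : nat) (M : manifold R n) :=
  gen_choiceMixin (vfield M).

Section VectorFields.
Context {R : realType} {n : nat} {M : manifold R n}.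
Implicit Types (X Y Z : vfield M) (f : Cinf M) (p : M).

Lemma vfield_eq X Y : (forall p, X p = Y p) -> X = Y.
Proof.
case: X Y => [X sX] [Y sY] /= XY; have {}XY : X = Y by apply: functional_extensionality_dep.
by rewrite XY in sX *; congr MkVField; exact: Prop_irrelevance.
Qed.

Lemma tangent_eq p (u v : tangent p) : (forall f, u f = v f) -> u = v.
Proof. by move=> uv; apply/val_inj/funext. Qed.

Fact vf0_smooth f : smooth (fun p => (0 : tangent p) f).
Proof. exact: (smooth_cst 0). Qed.
Fact vfD_smooth X Y f : smooth (fun p => (X p + Y p) f).
Proof. exact: smoothD (vfield_smooth X f) (vfield_smooth Y f). Qed.
Fact vfZ_smooth (h : Cinf M) X f : smooth (fun p => (h p *: X p) f).
Proof. exact: smoothM (CinfP h) (vfield_smooth X f). Qed.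
Fact vfN_smooth X f : smooth (fun p => (- X p) f).
Proof.
have -> : (fun p => (- X p) f) = cst (-1) * (fun p => X p f).
  by apply/funext => p; rewrite [RHS]mulN1r.
exact: smoothM (smooth_cst _) (vfield_smooth X f).
Qed.

Definition vf0 : vfield M := MkVField vf0_smooth.
Definition vfD X Y : vfield M := MkVField (vfD_smooth X Y).
Definition vfN X : vfield M := MkVField (vfN_smooth X).
Definition vfZ (h : Cinf M) X : vfield M := MkVField (vfZ_smooth h X).

Fact vfDA : associative vfD.
Proof. by move=> X Y Z; apply: vfield_eq => p; exact: addrA. Qed.
Fact vfDC : commutative vfD.
Proof. by move=> X Y; apply: vfield_eq => p; exact: addrC. Qed.
Fact vf0D : left_id vf0 vfD.
Proof. by move=> X; apply: vfield_eq => p; exact: add0r. Qed.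
Fact vfND : left_inverse vf0 vfN vfD.
Proof. by move=> X; apply: vfield_eq => p; exact: addNr. Qed.

HB.instance Definition _ := GRing.isZmodule.Build (vfield M) vfDA vfDC vf0D vfND.

Fact vfZA (f h : Cinf M) X : vfZ f (vfZ h X) = vfZ (f * h) X.
Proof. by apply: vfield_eq => p; exact: scalerA. Qed.
Fact vf1Z : left_id (1 : Cinf M) vfZ.
Proof. by move=> X; apply: vfield_eq => p; exact: scale1r. Qed.
Fact vfZDr : right_distributive vfZ +%R.
Proof. by move=> f X Y; apply: vfield_eq => p; exact: scalerDr. Qed.
Fact vfZDl X : {morph vfZ^~ X : f h / f + h}.
Proof. by move=> f h; apply: vfield_eq => p; exact: scalerDl. Qed.

HB.instance Definition _ :=
  GRing.Zmodule_isLmodule.Build (Cinf M) (vfield M) vfZA vf1Z vfZDr vfZDl.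

Definition vact X f : Cinf M := to_Cinf (vfield_smooth X f).

Lemma vact_lin X (a : R) f h :
  vact X (Cinf_cst a * f + h) = Cinf_cst a * vact X f + vact X h.
Proof.
by apply: Cinf_eq => p; have /derivation_predP[+ _] := tangent_mem (X p); apply.
Qed.

Lemma vactM X f h : vact X (f * h) = f * vact X h + h * vact X f.
Proof.
by apply: Cinf_eq => p; have /derivation_predP[_ +] := tangent_mem (X p); apply.
Qed.

Lemma vactD X f h : vact X (f + h) = vact X f + vact X h.
Proof.
have c1 : Cinf_cst 1 = 1 :> Cinf M by exact: Cinf_eq.
by have := vact_lin X 1 f h; rewrite c1 !mul1r.
Qed.

Definition bracket_fun X Y p f : R := (vact X (vact Y f) - vact Y (vact X f)) p.

Fact bracket_mem X Y p : bracket_fun X Y p \in derivation_pred p.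
Proof.
apply/derivation_predP; split=> [a f h|f h]; rewrite /bracket_fun.
  rewrite !vact_lin -[RHS]/((Cinf_cst a * _ + _) p).
  by congr (Cinf_fun _ p); ring.
rewrite !(vactM, vactD) -[RHS]/((f * _ + h * _) p).
by congr (Cinf_fun _ p); ring.
Qed.

Definition bracket_at X Y p : tangent p := MkTangent (bracket_mem X Y p).

Fact bracket_smooth X Y f : smooth (fun p => bracket_at X Y p f).
Proof. exact: CinfP (vact X (vact Y f) - vact Y (vact X f)). Qed.

Definition bracket X Y : vfield M := MkVField (bracket_smooth X Y).

End VectorFields.

Record riemannian (R : realType) (n : nat) (M : manifold R n) := MkRiemannian {
  metric :> forall p : M, tangent p -> tangent p -> R;
  metric_lin : forall p (a : R) (u v w : tangent p),
    metric (a *: u + v) w = a * metric u w + metric v w;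
  metric_sym : forall p (u v : tangent p), metric u v = metric v u;
  metric_pos : forall p (u : tangent p), u != 0 -> 0 < metric u u;
  metric_smooth : forall X Y : vfield M, smooth (fun p => metric (X p) (Y p)) }.

Record connection (R : realType) (n : nat) (M : manifold R n) := MkConnection {
  nabla :> vfield M -> vfield M -> vfield M;
  nabla_linl : forall (f : Cinf M) X X' Y,
    nabla (f *: X + X') Y = f *: nabla X Y + nabla X' Y;
  nablaD : forall X Y Y', nabla X (Y + Y') = nabla X Y + nabla X Y';
  nabla_leibniz : forall X (f : Cinf M) Y,
    nabla X (f *: Y) = vact X f *: Y + f *: nabla X Y }.

Section StatisticalGeometry.
Context {R : realType} {n : nat} {M : manifold R n}.
Implicit Types (g : riemannian M) (D : connection M) (X Y Z U : vfield M) (p : M).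

Definition ip g X Y : Cinf M := to_Cinf (metric_smooth g X Y).

Definition torsion_free D : Prop :=
  forall X Y, D X Y - D Y X = bracket X Y.

Definition nabla_metric g D X Y Z : Cinf M :=
  vact X (ip g Y Z) - ip g (D X Y) Z - ip g Y (D X Z).

(* The two transpositions generate all permutations of the three arguments. *)
Definition statistical g D : Prop :=
  torsion_free D /\
  forall X Y Z, nabla_metric g D X Y Z = nabla_metric g D Y X Z /\
                nabla_metric g D X Y Z = nabla_metric g D X Z Y.

Definition dual_connection g D D' : Prop :=
  forall X Y Z, vact X (ip g Y Z) = ip g (D X Y) Z + ip g Y (D' X Z).

Definition curvature D X Y Z : vfield M :=
  D X (D Y Z) - D Y (D X Z) - D (bracket X Y) Z.

(* Global vector fields whose values at p form a basis of the tangent space. *)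
Definition is_frame p (E : 'I_n -> vfield M) : Prop :=
  forall v : tangent p, exists! c : 'rV[R]_n, v = \sum_i c 0 i *: E i p.

(* Traces at p are computed in one chosen frame; traces of tensors do not
   depend on this choice.  The default value is never reached: every basis of
   T_pM extends to global vector fields. *)
Definition frame p : 'I_n -> vfield M := xget (fun=> 0) (is_frame p).

Definition frame_coord p (v : tangent p) : 'rV[R]_n :=
  xget (0 : 'rV[R]_n) [set c : 'rV[R]_n | v = \sum_i c 0 i *: frame p i p].

(* Trace at p of a (1,1)-tensor field. *)
Definition trace_at (L : vfield M -> vfield M) p : R :=
  \sum_i frame_coord (L (frame p i) p) 0 i.

Definition gram g p : 'M[R]_n :=
  \matrix_(i, j) g p (frame p i p) (frame p j p).

(* Metric trace at p of a (0,2)-tensor field: g^{ij} B_{ij}. *)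
Definition metric_trace g (B : vfield M -> vfield M -> M -> R) p : R :=
  \sum_i \sum_j invmx (gram g p) i j * B (frame p i) (frame p j) p.

Definition ricci D Y Z : M -> R := trace_at (fun X => curvature D X Y Z).

Definition scalar_curvature g D : M -> R := metric_trace g (ricci D).

(* A (1,1)-tensor field is a C^oo(M)-linear endomorphism of the module of
   vector fields. *)
Definition ricci_operator g D (Q : {linear vfield M -> vfield M}) : Prop :=
  forall X Y p, ip g (Q X) Y p = ricci D X Y p.

(* The value at p of W(X,Y)Z, for the connection D with dual D' and with Ricci
   operators Q of D and Q' of D'. *)
Definition cp_curvature g D D' (Q Q' : vfield M -> vfield M) X Y Z p :
    tangent p :=
  let N : R := n%:R in
  let Ric := ricci D in
  let Ric' := ricci D' in
  curvature D X Y Z p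
  + (N * (N - 2))^-1 *:
      ( ((N - 1) * Ric X Z p + Ric' X Z p) *: Y p
      - ((N - 1) * Ric Y Z p + Ric' Y Z p) *: X p
      + g p (X p) (Z p) *: ((N - 1) *: Q' Y p + Q Y p)
      - g p (Y p) (Z p) *: ((N - 1) *: Q' X p + Q X p))
  + (scalar_curvature g D p / ((N - 1) * (N - 2))) *:
      (g p (Y p) (Z p) *: X p - g p (X p) (Z p) *: Y p).

End StatisticalGeometry.

(* Main.v *)
Require Import Defs.
From mathcomp Require Import all_boot all_order all_algebra.
From mathcomp Require Import all_classical all_reals all_analysis.
From mathcomp Require Import ring.
Import Order.TTheory GRing.Theory Num.Theory.
Local Open Scope ring_scope.

(** Pairing the defining formula of W(X,Y)Z with U, and that of W*(X,Y)U with
    Z, turns the Ricci operators into the Ricci tensors.  All terms that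
    contain Ricci tensors then cancel pairwise, because the formula treats
    (Ric, Z) and (Ric*, U) symmetrically up to sign.  What remains is

      g(R(X,Y)Z,U) + g(R*(X,Y)U,Z)
        + (sigma - sigma* ) / ((n-1)(n-2)) * (g(Y,Z)g(X,U) - g(X,Z)g(Y,U)),

    and both parts vanish.

    The curvature part vanishes by [ip_curvature_dual]: the operator
    [X,Y] - XY + YX kills the function g(Z,U), and expanding it with the
    duality of the connections gives the two curvatures.

    The scalar curvatures agree ([scalar_curvature_dual]) because, in terms of
    a frame E, sigma is the contraction of g^{ij} g^{kl} with
    g(R(E_k,E_i)E_j,E_l).  The duality of the curvatures and the antisymmetry
    of R* in its first two arguments turn the latter into
    g(R*(E_i,E_k)E_l,E_j), which is the summand of sigma* after exchanging i
    with k and j with l. *)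

Section Bilinearity.
Context {R : realType} {n : nat} {M : manifold R n}.
Implicit Types (g : riemannian M) (D : connection M) (X Y Z : vfield M).

Lemma metricDl g p (u v w : tangent p) : g p (u + v) w = g p u w + g p v w.
Proof. by rewrite -[u in LHS]scale1r metric_lin mul1r. Qed.

Lemma metric0l g p (w : tangent p) : g p 0 w = 0.
Proof. by apply: (addrI (g p 0 w)); rewrite -metricDl !addr0. Qed.

Lemma metricZl g p a (u w : tangent p) : g p (a *: u) w = a * g p u w.
Proof. by rewrite -[a *: u]addr0 metric_lin metric0l addr0. Qed.

Lemma metricNl g p (u w : tangent p) : g p (- u) w = - g p u w.
Proof. by rewrite -scaleN1r metricZl mulN1r. Qed.

Lemma metric_suml g p k (c : 'I_k -> R) (e : 'I_k -> tangent p) w :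
  g p (\sum_i c i *: e i) w = \sum_i c i * g p (e i) w.
Proof.
elim/big_rec2: _ => [|i y1 y2 _ IH]; first exact: metric0l.
by rewrite metric_lin IH.
Qed.

Lemma ipC g X Y : ip g X Y = ip g Y X.
Proof. by apply: Cinf_eq => p; rewrite -[LHS]/(g p (X p) (Y p)) Defs.metric_sym. Qed.

Lemma ipBl g X Y Z : ip g (X - Y) Z = ip g X Z - ip g Y Z.
Proof.
by apply: Cinf_eq => p; rewrite -[LHS]/(g p (X p - Y p) (Z p)) metricDl metricNl.
Qed.

Lemma ipNl g X Y : ip g (- X) Y = - ip g X Y.
Proof. by apply: Cinf_eq => p; rewrite -[LHS]/(g p (- X p) (Y p)) metricNl. Qed.

Lemma bracketC X Y : bracket Y X = - bracket X Y.
Proof.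
apply: vfield_eq => p; apply: tangent_eq => f.
by rewrite -[LHS]/((vact Y (vact X f) - vact X (vact Y f)) p) -opprB.
Qed.

Lemma nabla0l D Y : D 0 Y = 0.
Proof.
by apply: (addrI (D 0 Y)); rewrite -{1}[D 0 Y]scale1r -nabla_linl scaler0 !addr0.
Qed.

Lemma nablaNl D X Y : D (- X) Y = - D X Y.
Proof. by rewrite -scaleN1r -[_ *: X]addr0 nabla_linl nabla0l addr0 scaleN1r. Qed.

Lemma curvatureC D X Y Z : curvature D Y X Z = - curvature D X Y Z.
Proof. by rewrite /curvature bracketC nablaNl opprK [RHS]opprB opprB addrC. Qed.

Lemma curvature0l D Y Z : curvature D 0 Y Z = 0.
Proof.
have DY0 : D Y 0 = 0 by apply: (addrI (D Y 0)); rewrite -nablaD !addr0.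
have b0 : bracket 0 Y = 0.
  apply: vfield_eq => p; apply: tangent_eq => f.
  rewrite -[LHS]/((vact 0 (vact Y f) - vact Y (vact 0 f)) p).
  have v0 h : vact (0 : vfield M) h = 0 by exact: Cinf_eq.
  suff -> : vact Y (vact 0 f) = 0 by rewrite v0 subrr.
  by rewrite v0; apply: (addrI (vact Y 0)); rewrite -vactD !addr0.
by rewrite /curvature b0 !nabla0l DY0 !subr0.
Qed.

End Bilinearity.

(** In the difference of the two second derivatives of g(Z,U) the mixed terms
    g(D_X Z, D'_Y U) cancel.  The bracket enters only through its action on
    the function g(Z,U), to which the duality applies once more. *)
Lemma ip_curvature_dual {R : realType} {n : nat} {M : manifold R n}
    {g : riemannian M} {D D' : connection M} (X Y Z U : vfield M) :
  dual_connection g D D' ->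
  ip g (curvature D X Y Z) U = - ip g (curvature D' X Y U) Z.
Proof.
move=> dual; rewrite /curvature !ipBl.
have brE f : vact (bracket X Y) f = vact X (vact Y f) - vact Y (vact X f).
  exact: Cinf_eq.
have := brE (ip g Z U); rewrite !dual !vactD !dual.
rewrite !(ipC g (D' _ _) Z) => /eqP; rewrite -subr_eq0 => /eqP E.
by apply/eqP; rewrite -subr_eq0 -oppr_eq0; apply/eqP; rewrite -[RHS]E; ring.
Qed.

Section ScalarCurvature.
Context {R : realType} {n : nat} {M : manifold R n} (g : riemannian M).
Implicit Types (D : connection M) (p : M).

Lemma gram_sym p i j : gram g p i j = gram g p j i.
Proof. by rewrite !mxE Defs.metric_sym. Qed.

Lemma invmx_gram_sym p i j : invmx (gram g p) i j = invmx (gram g p) j i.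
Proof.
have GT : (gram g p)^T = gram g p by apply/matrixP => k l; rewrite mxE gram_sym.
by rewrite -[in LHS]GT -trmx_inv mxE.
Qed.

(** A vector v = sum c_i E_i with c *m G = 0 is orthogonal to itself, so
    v = 0, and independence of the frame gives c = 0. *)
Lemma gram_unit p : is_frame p (frame p) -> gram g p \in unitmx.
Proof.
move=> fr; rewrite -row_free_unit -kermx_eq0; apply/rowV0P => c /sub_kermxP cG.
set v := \sum_i c 0 i *: frame p i p.
have vE j : g p v (frame p j p) = 0.
  transitivity ((c *m gram g p) 0 j); last by rewrite cG mxE.
  by rewrite metric_suml mxE; apply: eq_bigr => i _; rewrite mxE.
have vv : g p v v = 0.
  rewrite {1}/v metric_suml big1 // => i _.
  by rewrite Defs.metric_sym vE mulr0.
have v0 : v = 0.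
  by apply/eqP; apply: contraT => /(metric_pos g); rewrite vv ltxx.
have [d [_ dU]] := fr 0.
rewrite -(dU c) ?v0 //; apply: dU.
by rewrite big1 // => i _; rewrite mxE scale0r.
Qed.

Lemma frame_coordE p (v : tangent p) i : is_frame p (frame p) ->
  frame_coord v 0 i = \sum_j invmx (gram g p) j i * g p v (frame p j p).
Proof.
move=> fr; have [c [vc _]] := fr v.
have cE : v = \sum_i frame_coord v 0 i *: frame p i p.
  by rewrite /frame_coord; case: xgetP => [d _ //|/(_ c)[]].
have /matrixP/(_ 0 i) : frame_coord v =
    (\row_j g p v (frame p j p)) *m invmx (gram g p).
  rewrite -[LHS](mulmxK (gram_unit p fr)); congr (_ *m _).
  apply/rowP => j; rewrite !mxE {2}cE metric_suml.
  by apply: eq_bigr => k _; rewrite mxE.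
by move=> ->; rewrite mxE; apply: eq_bigr => j _; rewrite mxE mulrC.
Qed.

Lemma scalar_curvatureE D p : is_frame p (frame p) ->
  scalar_curvature g D p = \sum_i \sum_j \sum_k \sum_l
    invmx (gram g p) i j * invmx (gram g p) l k *
    ip g (curvature D (frame p k) (frame p i) (frame p j)) (frame p l) p.
Proof.
move=> fr; apply: eq_bigr => i _; apply: eq_bigr => j _.
rewrite /ricci /trace_at mulr_sumr; apply: eq_bigr => k _.
rewrite frame_coordE // mulr_sumr; apply: eq_bigr => l _.
by rewrite mulrA.
Qed.

(** Both traces are taken in the vectors [frame p].  The degenerate case, where
    these are not a frame, is settled directly: they are then all 0, so both
    sides are the same expression in the vanishing curvatures. *)
Lemma scalar_curvature_dual D D' p : dual_connection g D D' ->
  scalar_curvature g D p = scalar_curvature g D' p.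
Proof.
move=> dual; have [fr|nfr] := pselect (is_frame p (frame p)); last first.
  have E0 i : frame p i = 0 by move: nfr; rewrite /frame; case: xgetP.
  apply: eq_bigr => i _; apply: eq_bigr => j _; congr (_ * _).
  by apply: eq_bigr => k _; rewrite !E0 !curvature0l.
rewrite !scalar_curvatureE //.
pose F D i j k l := invmx (gram g p) i j * invmx (gram g p) l k *
  ip g (curvature D (frame p k) (frame p i) (frame p j)) (frame p l) p.
rewrite -/(\sum_i \sum_j \sum_k \sum_l F D i j k l).
rewrite -/(\sum_i \sum_j \sum_k \sum_l F D' i j k l).
transitivity (\sum_i \sum_j \sum_k \sum_l F D' k l i j).
  apply: eq_bigr => i _; apply: eq_bigr => j _.
  apply: eq_bigr => k _; apply: eq_bigr => l _.
  rewrite /F (ip_curvature_dual _ _ _ _ dual) curvatureC ipNl opprK.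
  rewrite (invmx_gram_sym p l k) (invmx_gram_sym p i j).
  by congr (_ * _); exact: mulrC.
(* turn the order of summation i, j, k, l into k, l, i, j *)
under eq_bigr do rewrite exchange_big.
rewrite exchange_big; apply: eq_bigr => k _.
under eq_bigr do rewrite exchange_big.
by rewrite exchange_big.
Qed.

End ScalarCurvature.

Theorem theorem2p1 (R : realType) (n : nat) (hn : (3 <= n)%N)
  (M : manifold R n) (g : riemannian M) (D D' : connection M)
  (hstat : statistical g D) (hdual : dual_connection g D D')
  (Q Q' : {linear vfield M -> vfield M})
  (hQ : ricci_operator g D Q) (hQ' : ricci_operator g D' Q') :
  forall (X Y Z U : vfield M) (p : M),
    g p (cp_curvature g D D' Q Q' X Y Z p) (U p)
    + g p (cp_curvature g D' D Q' Q X Y U p) (Z p) = 0.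
Proof.
move=> X Y Z U p.
have gQ (V V' : vfield M) : g p (Q V p) (V' p) = ricci D V V' p by exact: hQ.
have gQ' (V V' : vfield M) : g p (Q' V p) (V' p) = ricci D' V V' p by exact: hQ'.
have gR : g p (curvature D X Y Z p) (U p) = - g p (curvature D' X Y U p) (Z p).
  by have /(congr1 (fun f : Cinf M => f p)) := ip_curvature_dual X Y Z U hdual.
rewrite /cp_curvature (scalar_curvature_dual _ _ _ _ hdual).
(* made opaque, so that additivity of the metric does not expand them *)
move: (curvature D X Y Z p) (curvature D' X Y U p) gR => r r' gR.
rewrite !(metricDl, metricNl, metricZl) !gQ !gQ' gR.
move: (_ ^-1) (_ / _) => a b; ring.
Qed.
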